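(* For every $\rho\in[1,\frac{e}{e-1}]$ and every (possibly randomized) algorithm $\mathcal{A}$ for learning-augmented ski rental, there is a ski rental instance, with some prediction error $\eta$, on which the expected cost of $\mathcal{A}$ is at least $\rho\cdot\mathrm{OPT}+\mu(\rho)\cdot\eta$.
   Context: Learning-augmented continuous-time ski rental: there is a rental cost $\alpha>0$ per unit time and a buying cost $\beta>0$. The season length $\ell\ge 0$ is unknown to the algorithm; the algorithm knows $\alpha,\beta$ and a prediction $\tau\ge 0$ of $\ell$. A (randomized) algorithm chooses a (random) buying time $A\in[0,\infty]$ depending only on $\alpha,\beta,\tau$; its cost is $\alpha A+\beta$ if $A<\ell$ and $\alpha\ell$ otherwise. The optimal offline cost is $\mathrm{OPT}=\min\{\alpha\ell,\beta\}$ and the prediction error is $\eta=\alpha|\tau-\ell|$. For $\rho\in[1,\frac{e}{e-1}]$ define $\mu(\rho)=\max\left\{\frac{1-\rho\frac{e-1}{e}}{\ln 2},\ \rho(1-T)e^{-T}\right\}$, where $T\in[0,1]$ is the solution of $T^2e^{-T}=1-\frac1\rho$. *)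

(* Defs.v *)
From HB Require Import structures.
From mathcomp Require Import all_boot all_order all_algebra.
From mathcomp Require Import ring lra.
From mathcomp Require Import all_classical all_reals all_analysis.
From mathcomp Require Import measurable_realfun.

Set Implicit Arguments.
Unset Strict Implicit.
Unset Printing Implicit Defensive.

Import Order.TTheory GRing.Theory Num.Theory.
Import numFieldNormedType.Exports.

Local Open Scope classical_set_scope.
Local Open Scope ring_scope.

(* [buy_time A alpha beta tau w] is the buying time chosen on rental cost alpha,
   buying cost beta and prediction tau when the random seed is w : Omega; the
   value +oo means never buying. The season length is not an argument. *)
Record ski_algorithm (R : realType) (d : measure_display)
    (Omega : measurableType d) := SkiAlgorithm {
  buy_time :> R -> R -> R -> Omega -> \bar R ;
  buy_time_ge0 : forall alpha beta tau w, (0 <= buy_time alpha beta tau w)%E ;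
  measurable_buy_time : forall alpha beta tau,
    measurable_fun setT (buy_time alpha beta tau) }.

(* The first branch is only reached with a finite, so [fine a] is a itself. *)
Definition ski_cost (R : realType) (alpha beta ell : R) (a : \bar R) : R :=
  if (a < ell%:E)%E then alpha * fine a + beta else alpha * ell.

Definition expected_ski_cost (R : realType) (d : measure_display)
    (Omega : measurableType d) (P : probability Omega R)
    (A : ski_algorithm R Omega) (alpha beta tau ell : R) : \bar R :=
  'E_P[fun w => ski_cost alpha beta ell (A alpha beta tau w)]%E.

Definition ski_opt (R : realType) (alpha beta ell : R) : R :=
  Num.min (alpha * ell) beta.

Definition pred_error (R : realType) (alpha tau ell : R) : R :=
  alpha * `|tau - ell|.

Definition mu_T_spec (R : realType) (rho : R) : set R :=
  [set T | 0 <= T <= 1 /\ T ^+ 2 * expR (- T) = 1 - rho^-1].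

(* The default value 0 is irrelevant for 1 <= rho <= e / (e - 1): see [mu_TP]
   and [mu_T_uniq]. *)
Definition mu_T (R : realType) (rho : R) : R := xget 0 (mu_T_spec rho).

Definition mu (R : realType) (rho : R) : R :=
  let e := expR 1 in
  let T := mu_T rho in
  Num.max ((1 - rho * ((e - 1) / e)) / ln 2) (rho * (1 - T) * expR (- T)).

Lemma mu_TP (R : realType) (rho : R) :
  1 <= rho <= expR 1 / (expR 1 - 1) -> mu_T_spec rho (mu_T rho).
Proof.
move=> /andP[rho1 rhoe]; apply: xgetPex.
have e2 : (2 : R) <= expR 1 by rewrite (le_trans _ (expR_ge1Dx 1)).
have rho0 : 0 < rho by apply: lt_le_trans rho1.
pose f (x : R) := x ^+ 2 * expR (- x).
have cf : continuous f.
  move=> x; apply: cvgM; first exact: exprn_continuous.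
  by apply: continuous_comp; [exact: opp_continuous|exact: continuous_expR].
have le01 : (0 : R) <= 1 by [].
have f0 : f 0 = 0 by rewrite /f expr0n mul0r.
have f1 : f 1 = (expR 1)^-1 by rewrite /f expr1n mul1r expRN.
have lb : 0 <= 1 - rho^-1 by rewrite subr_ge0 invf_le1.
have ub : 1 - rho^-1 <= (expR 1)^-1.
  have : (expR 1 / (expR 1 - 1))^-1 <= rho^-1.
    by rewrite lef_pV2 // posrE divr_gt0 //; lra.
  rewrite invf_div => H; have : (expR 1 - 1) / expR 1 = 1 - (expR 1)^-1 :> R.
    by rewrite mulrBl divff ?mul1r // gt_eqF ?expR_gt0.
  by lra.
have hv : Num.min (f 0) (f 1) <= 1 - rho^-1 <= Num.max (f 0) (f 1).
  by rewrite f0 f1 ge_min le_max lb ub orbT.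
have [c c01 fc] := IVT le01 (continuous_subspaceT cf) hv.
by exists c; split => //; move: c01; rewrite in_itv.
Qed.

Lemma mu_T_uniq (R : realType) (rho x y : R) :
  mu_T_spec rho x -> mu_T_spec rho y -> x = y.
Proof.
wlog xy : x y / x <= y => [H sx sy|].
  by case: (leP x y) => [|/ltW] h; [|apply/esym]; apply: H.
move=> [/andP[x0 x1] Ex] [/andP[y0 y1]]; rewrite -Ex => E {Ex}.
apply/eqP; rewrite eq_le xy leNgt; apply/negP => ltxy.
have {E} E : x ^+ 2 = y ^+ 2 * expR (- (y - x)).
  rewrite opprB addrC expRD mulrA E -mulrA -expRD.
  by rewrite (addrC (- x)) subrr expR0 mulr1.
have := expR_ge1Dx (- (y - x)) => H.
have Hx : y ^+ 2 * (1 + - (y - x)) <= x ^+ 2 by rewrite E ler_wpM2l // sqr_ge0.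
have {E}x_gt0 : 0 < x.
  rewrite lt_neqAle x0 andbT; apply/eqP => xE.
  have : 0 < y ^+ 2 * expR (- (y - x)).
    by rewrite mulr_gt0 ?expR_gt0 // exprn_gt0 // (le_lt_trans x0).
  by rewrite -E -xE expr0n ltxx.
have : 0 < (y - x) * (x + y * (1 - y)).
  by rewrite mulr_gt0 ?subr_gt0 // ltr_pwDl // mulr_ge0 // subr_ge0.
by nra.
Qed.

(* Main.v *)
Require Import Defs.
From HB Require Import structures.
From mathcomp Require Import all_boot all_order all_algebra.
From mathcomp Require Import ring lra.
From mathcomp Require Import all_classical all_reals all_analysis.
From mathcomp Require Import measurable_realfun.

(* Rescale so that renting costs 1 per unit of time and buying costs 1. For
   0 <= m <= 1 draw the season length as 1 - m with probability 1 - m and as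
   1 - m + Exp(1) with probability m. Every buying time then costs at least 1 on
   average, while OPT averages to 1 - m e^(-m). For m = 1 and the prediction
   ln 2 (the median of Exp(1)) the error averages to ln 2; for m = T and the
   prediction 1 - T it averages to T. In both cases the average of
   rho OPT + mu eta is exactly 1, mu being respectively the first and the second
   term of the maximum. By Fubini some season length is as bad as the average;
   it can be taken positive because the atom at 1 - m = 0 has no mass. *)

Import Order.TTheory GRing.Theory Num.Theory.
Import numFieldNormedType.Exports.
Local Open Scope classical_set_scope.
Local Open Scope ring_scope.

(** * Integrals of affine and truncated functions against e^(-x) *)

Section exponential_integrals.
Context {R : realType}.
Notation mu := (@lebesgue_measure R).
Implicit Types a b p q x : R.

Let primitive p q x : R := - ((p + q + q * x) * expR (- x)).

Let is_derive_primitive p q x :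
  is_derive x 1 (primitive p q) ((p + q * x) * expR (- x)).
Proof.
rewrite /primitive; apply: is_derive_eq.
rewrite /GRing.scale /=; ring.
Qed.

Let continuous_affine_expR p q :
  continuous (fun x => (p + q * x) * expR (- x)).
Proof.
move=> x; apply/differentiable_continuous/derivable1_diffP.
exact: ex_derive.
Qed.

Let continuous_primitive p q : continuous (primitive p q).
Proof.
move=> x; apply/differentiable_continuous/derivable1_diffP.
exact: ex_derive.
Qed.

Lemma integral_affine_expR a b p q : a <= b ->
  (\int[mu]_(x in `[a, b]) ((p + q * x) * expR (- x))%:E =
   ((p + q + q * a) * expR (- a) - (p + q + q * b) * expR (- b))%:E)%E.
Proof.
rewrite le_eqVlt => /predU1P[->|ab].
  by rewrite set_itv1 integral_set1 subrr.
rewrite (@continuous_FTC2 _ _ (primitive p q))//.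
- by rewrite /primitive -EFinB opprK addrC.
- exact/continuous_subspaceT/continuous_affine_expR.
- split.
  + by move=> x _; exact: ex_derive.
  + exact/cvg_at_right_filter/continuous_primitive.
  + exact/cvg_at_left_filter/continuous_primitive.
- by move=> x _; rewrite derive1E; exact: derive_val.
Qed.

(** Half of the exponential absorbs the factor: x/2 <= e^(x/2), hence 0 <= x e^(-x) <= 2 e^(-x/2)
    for x >= 0. *)
Lemma cvgr_mulr_expRN : x * expR (- x) @[x --> +oo] --> (0 : R).
Proof.
apply: (@squeeze_cvgr _ _ _ _ (fun=> 0) (fun x => 2 * expR (- (2^-1 * x)))).
- near=> x.
  have x0 : 0 <= x by near: x; exact: nbhs_pinfty_ge.
  rewrite mulr_ge0 ?expR_ge0//=.
  have -> : - x = - (2^-1 * x) + - (2^-1 * x) by lra.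
  rewrite expRD mulrA ler_wpM2r ?expR_ge0// expRN ler_pdivrMr ?expR_gt0//.
  have := expR_ge1Dx (2^-1 * x); lra.
- exact: cvg_cst.
- rewrite -(mulr0 2); apply: cvgM; first exact: cvg_cst.
  apply: (@cvg_comp _ _ _ (fun x : R => 2^-1 * x) (fun x => expR (- x))
    _ (pinfty_nbhs R)); last exact: cvgr_expR.
  exact: gt0_cvgMry.
Unshelve. all: by end_near. Qed.

(** The two sign conditions make the integrand nonnegative on the whole half-line, as the improper
    fundamental theorem of calculus requires; the antiderivative vanishes at infinity. *)
Lemma integral_affine_expRy a p q : 0 <= q -> 0 <= p + q * a ->
  (\int[mu]_(x in `[a, +oo[) ((p + q * x) * expR (- x))%:E =
   ((p + q + q * a) * expR (- a))%:E)%E.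
Proof.
move=> q0 pq0.
rewrite (@ge0_continuous_FTC2y _ _ (primitive p q) _ 0)//.
- by rewrite /primitive sub0e -EFinN opprK.
- move=> x ax; rewrite mulr_ge0 ?expR_ge0// (le_trans pq0)// lerD2l.
  exact: ler_wpM2l.
- exact/continuous_subspaceT/continuous_affine_expR.
- rewrite /primitive.
  under eq_fun do rewrite mulrDl -mulrA.
  rewrite -oppr0; apply: cvgN; rewrite -(addr0 0).
  apply: cvgD; [rewrite -[X in _ --> X](mulr0 (p + q))|
                rewrite -[X in _ --> X](mulr0 q)]; apply: cvgM.
  + exact: cvg_cst.
  + exact: cvgr_expR.
  + exact: cvg_cst.
  + exact: cvgr_mulr_expRN.
- exact/cvg_at_right_filter/continuous_primitive.
- by move=> x _; rewrite derive1E; exact: derive_val.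
Qed.

Lemma measurable_mul_expRN (D : set R) (f : R -> R) :
  measurable_fun setT f ->
  measurable_fun D (EFin \o (fun x => f x * expR (- x))).
Proof.
move=> mf; apply/measurable_EFinP/measurable_funTS/measurable_funM => //.
exact: measurableT_comp.
Qed.

Lemma integral_idfun_expR :
  (\int[mu]_(x in `]0%R, +oo[) (x * expR (- x))%:E = 1)%E.
Proof.
rewrite integral_itv_obnd_cbnd; last exact: measurable_mul_expRN.
under eq_integral do rewrite -[X in (X * _)%R]mul1r -[X in (X * _)%R]add0r.
rewrite integral_affine_expRy ?mulr0 ?addr0//.
by rewrite add0r oppr0 expR0 mulr1.
Qed.

Lemma measurable_fun_truncation b p :
  measurable_fun setT (fun x => if x <= b then x else p).
Proof. by apply: measurable_fun_ifT => //; exact: measurable_fun_ler. Qed.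

(** One formula for three uses: [p = b] gives the mean of min(x, b), [p = b + 1] the mean cost of
    buying at time [b] under unit costs, and [b = 0], [p = 1] the total mass. *)
Lemma integral_truncation_expR b p : 0 <= b -> 0 <= p ->
  (\int[mu]_(x in `]0%R, +oo[)
     ((if (x <= b)%R then x else p) * expR (- x))%:E =
   (1 - (1 + b) * expR (- b) + p * expR (- b))%:E)%E.
Proof.
move=> b0 p0; have mT := measurable_fun_truncation b p.
rewrite (@itv_bndbnd_setU _ _ (BRight 0) (BRight b)) ?bnd_simp//.
rewrite ge0_integral_setU//=; first last.
- apply/disj_setPS => x [/=]; rewrite !in_itv/= andbT => /andP[_ xb].
  by rewrite ltNge xb.
- move=> x []; rewrite /= in_itv/= => /andP[x0 xb]; rewrite lee_fin;
    rewrite mulr_ge0 ?expR_ge0//; case: ifP => // _; first exact: ltW.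
  exact: le_trans (ltW x0).
- exact: measurable_mul_expRN.
rewrite [X in (X + _)%E](_ : _ =
    \int[mu]_(x in `]0%R, b]) ((0 + 1 * x) * expR (- x))%:E)%E; last first.
  apply: eq_integral => x; rewrite inE/= in_itv/= => /andP[_ ->].
  by rewrite mul1r add0r.
rewrite [X in (_ + X)%E](_ : _ =
    \int[mu]_(x in `]b, +oo[) ((p + 0 * x) * expR (- x))%:E)%E; last first.
  apply: eq_integral => x; rewrite inE/= in_itv/= andbT => bx.
  by rewrite leNgt bx mul0r addr0.
rewrite !integral_itv_obnd_cbnd.
- rewrite integral_affine_expR// integral_affine_expRy ?mul0r ?addr0//.
  rewrite -EFinD oppr0 expR0; congr EFin; lra.
- by apply: measurable_mul_expRN; apply: measurable_funD => //;
    exact: measurable_funM.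
- by apply: measurable_mul_expRN; apply: measurable_funD => //;
    exact: measurable_funM.
Qed.

Lemma integral_expR_gt0 : (\int[mu]_(x in `]0%R, +oo[) (expR (- x))%:E = 1)%E.
Proof.
rewrite -[RHS](_ : (1 - (1 + 0) * expR (- 0) + 1 * expR (- 0) : R)%:E = _);
  last by rewrite oppr0 expR0; congr EFin; lra.
rewrite -integral_truncation_expR//; apply: eq_integral => x.
by rewrite inE/= in_itv/= andbT leNgt => ->; rewrite mul1r.
Qed.
End exponential_integrals.

(** Equality would give the nonnegative function [g - f] integral 0 on [D], so it would vanish
    almost everywhere there; being positive on all of [D], it would force [D] to be null. Finiteness
    of the integral of [g] makes that of [f] a real number, so that adding a positive amount to it
    is strict. *)
Lemma lt_integral (d : measure_display) (T : measurableType d) (R : realType)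
    (mu : {measure set T -> \bar R}) (D : set T) (f g : T -> R) :
  measurable D -> (0 < mu D)%E ->
  measurable_fun D (EFin \o f) -> measurable_fun D (EFin \o g) ->
  (forall x, D x -> 0 <= f x) -> (forall x, D x -> f x < g x) ->
  (\int[mu]_(x in D) (g x)%:E < +oo)%E ->
  (\int[mu]_(x in D) (f x)%:E < \int[mu]_(x in D) (g x)%:E)%E.
Proof.
move=> mD D0 mf mg f0 fg goo.
pose h x : R := g x - f x.
have mfg : measurable_fun D (EFin \o h).
  by apply/measurable_EFinP/measurable_funB; apply/measurable_EFinP.
have fg0 x : D x -> 0 <= g x - f x by move=> Dx; rewrite subr_ge0 ltW// fg.
have gE : (\int[mu]_(x in D) (g x)%:E =
    \int[mu]_(x in D) (f x)%:E + \int[mu]_(x in D) (g x - f x)%:E)%E.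
  rewrite -ge0_integralD//.
  by apply: eq_integral => x _; rewrite -EFinD addrC subrK.
have f_ge0 : (0 <= \int[mu]_(x in D) (f x)%:E)%E.
  by apply: integral_ge0 => x Dx; rewrite lee_fin f0.
have d_ge0 : (0 <= \int[mu]_(x in D) (g x - f x)%:E)%E.
  by apply: integral_ge0 => x Dx; rewrite lee_fin fg0.
have ffin : (\int[mu]_(x in D) (f x)%:E)%E \is a fin_num.
  by rewrite ge0_fin_numE// (le_lt_trans _ goo)// gE leeDl.
rewrite gE lteDl// lt_neqAle d_ge0 andbT; apply/eqP => d0.
have /(ae_eq_integral_abs mu mD mfg)[N [mN N0 DN]] :
    (\int[mu]_(x in D) `|(EFin \o h) x| = 0)%E.
  rewrite d0; apply: eq_integral => x; rewrite inE => Dx /=.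
  by rewrite ger0_norm// fg0.
move: D0; rewrite (subset_measure0 mD mN _ N0) ?ltxx//.
apply: subset_trans DN => x Dx /= /(_ Dx)[] /eqP.
by rewrite subr_eq0 gt_eqF// fg.
Qed.

(** * Expectations under the Exp(1) distribution *)

Section exponential_mean.
Context {R : realType}.
Implicit Types (f g : R -> R) (b m s u v x y : R).

(** The interval is open at 0, so conditions on [f] are asked only at positive points; this is what
    later allows a positive season length. *)
Definition exponential_mean f : \bar R :=
  (\int[lebesgue_measure]_(x in `]0%R, +oo[) (f x * expR (- x))%:E)%E.

Lemma eq_exponential_mean f g : (forall x, 0 < x -> f x = g x) ->
  exponential_mean f = exponential_mean g.
Proof.
move=> fg; apply: eq_integral => x.
by rewrite inE/= in_itv/= andbT => /fg ->.
Qed.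

Lemma exponential_mean_ge0 f : (forall x, 0 < x -> 0 <= f x) ->
  (0 <= exponential_mean f)%E.
Proof.
move=> f0; apply: integral_ge0 => x; rewrite /= in_itv/= andbT => x0.
by rewrite lee_fin mulr_ge0 ?expR_ge0 ?f0.
Qed.

Lemma exponential_mean_linear u v f g :
  0 <= u -> 0 <= v -> measurable_fun setT f -> measurable_fun setT g ->
  (forall x, 0 < x -> 0 <= f x) -> (forall x, 0 < x -> 0 <= g x) ->
  (exponential_mean (fun x => u * f x + v * g x)%R =
   u%:E * exponential_mean f + v%:E * exponential_mean g)%E.
Proof.
move=> u0 v0 mf mg f0 g0; rewrite /exponential_mean.
have ge0 (h : R -> R) x : (forall y, 0 < y -> 0 <= h y) ->
    `](0 : R), +oo[%classic x ->
    (0 <= (h x * expR (- x))%:E)%E.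
  move=> h0; rewrite /= in_itv/= andbT => /h0 hx.
  by rewrite lee_fin mulr_ge0 ?expR_ge0.
have mM (h : R -> R) : measurable_fun setT h ->
    measurable_fun `](0 : R), +oo[ (EFin \o (fun x => h x * expR (- x))).
  exact: measurable_mul_expRN.
rewrite -!ge0_integralZl//; try exact: mM; try by move=> x; exact: ge0.
rewrite -ge0_integralD//.
- by apply: eq_integral => x _; rewrite -EFinD mulrDl !mulrA.
- by move=> x Dx; apply: mule_ge0; [rewrite lee_fin|exact: ge0].
- by apply: measurable_funeM; exact: mM.
- by move=> x Dx; apply: mule_ge0; [rewrite lee_fin|exact: ge0].
- by apply: measurable_funeM; exact: mM.
Qed.

Lemma exponential_mean_idfun : exponential_mean idfun = 1%E.
Proof. exact: integral_idfun_expR. Qed.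

Lemma exponential_mean_cst1 : exponential_mean (fun=> 1) = 1%E.
Proof.
rewrite -[RHS]integral_expR_gt0; apply: eq_integral => x _.
by rewrite mul1r.
Qed.

Lemma exponential_mean_shift s f :
  0 <= s -> measurable_fun setT f -> (forall x, 0 < x -> 0 <= f x) ->
  exponential_mean (fun x => s + f x) = (s%:E + exponential_mean f)%E.
Proof.
move=> s0 mf f0.
rewrite -[X in (X + _)%E]mule1 -exponential_mean_cst1 -[X in (_ + X)%E]mul1e.
rewrite -exponential_mean_linear//.
by apply: eq_exponential_mean => x _; rewrite mulr1 mul1r.
Qed.

Lemma exponential_mean_cst s : 0 <= s -> exponential_mean (fun=> s) = s%:E.
Proof.
move=> s0; rewrite (_ : (fun=> s) = (fun x => s * 1 + 0 * 1)).
  by rewrite exponential_mean_linear// exponential_mean_cst1 mul0e adde0 mule1.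
by apply/funext => x; lra.
Qed.

Lemma exponential_mean_minr b : 0 <= b ->
  exponential_mean (fun x => Num.min x b) = (1 - expR (- b))%:E.
Proof.
move=> b0; rewrite (@eq_exponential_mean _ (fun x => if x <= b then x else b)).
  rewrite /exponential_mean integral_truncation_expR//; congr EFin; lra.
by move=> x _; case: leP.
Qed.

(** For x > 0, |b - x| + 2 min(x, b) = b + x. Taking means of both sides and solving for the first
    term avoids a new integral. *)
Lemma exponential_mean_dist b : 0 <= b ->
  exponential_mean (fun x => `|b - x|) = (b - 1 + 2 * expR (- b))%:E.
Proof.
move=> b0.
have mmin : measurable_fun setT (fun x => Num.min x b) by exact: measurable_minr.
have mdist : measurable_fun setT (fun x : R => `|b - x|).
  by apply: measurableT_comp => //; exact: measurable_funB.
have min0 x : 0 < x -> 0 <= Num.min x b by move=> x0; rewrite le_min b0 ltW.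
have := @eq_exponential_mean (fun x => 1 * `|b - x| + 2 * Num.min x b)
  (fun x => b * 1 + 1 * idfun x).
rewrite !exponential_mean_linear//; last 2 first.
- exact: measurable_id.
- by move=> x /ltW.
rewrite exponential_mean_minr// exponential_mean_cst1 exponential_mean_idfun.
rewrite mule1 mul1e => /(_ _)/wrap[].
  by move=> x x0; rewrite /=; case: (leP x b) => xb;
    [rewrite ger0_norm|rewrite ler0_norm]; lra.
case: (exponential_mean _) => [r| |]//=.
rewrite -!EFinM -!EFinD => -[] rE; congr EFin; lra.
Qed.

End exponential_mean.

(** * Reduction to unit costs and a lower bound for every fixed buying time *)

Section unit_costs.
Context {R : realType}.
Implicit Types (a : \bar R) (alpha beta ell m s x : R).
Local Notation unit_cost := (@ski_cost R 1 1).

Lemma ski_cost_ge0 alpha beta ell a : 0 <= alpha -> 0 <= beta -> 0 <= ell ->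
  (0 <= a)%E -> 0 <= ski_cost alpha beta ell a.
Proof.
move=> alpha0 beta0 ell0 a0; rewrite /ski_cost; case: ifP => _.
  by rewrite addr_ge0// mulr_ge0// fine_ge0.
exact: mulr_ge0.
Qed.

(** Time is measured in multiples of [beta / alpha], the time at which renting has cost as much as
    buying, and money in multiples of [beta]. *)
Lemma ski_cost_scale alpha beta x a : 0 < alpha -> 0 < beta ->
  ski_cost alpha beta (beta / alpha * x) a =
  beta * unit_cost x ((alpha / beta)%:E * a)%E.
Proof.
move=> alpha0 beta0; rewrite /ski_cost.
have ab0 : 0 < alpha / beta by rewrite divr_gt0.
have alphaN0 : alpha != 0 by rewrite gt_eqF.
have betaN0 : beta != 0 by rewrite gt_eqF.
have xE : x = alpha / beta * (beta / alpha * x) by field; apply/andP.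
have -> : ((alpha / beta)%:E * a < x%:E)%E = (a < (beta / alpha * x)%:E)%E.
  by rewrite [in LHS]xE [X in (_ < X)%E]EFinM lte_pmul2l ?lte_fin.
case: ifP => [|_]; last by field.
case: a => [r| |]//= _; last by rewrite gt0_muleNy ?lte_fin//=; field.
by field.
Qed.

Lemma measurable_ski_cost (d : measure_display) (T : measurableType d)
    alpha beta (f : T -> R) (X : T -> \bar R) :
  measurable_fun setT f -> measurable_fun setT X ->
  measurable_fun setT (fun w => ski_cost alpha beta (f w) (X w)).
Proof.
move=> mf mX; apply: measurable_fun_ifT.
- by apply: measurable_fun_lte => //; exact/measurable_EFinP.
- apply: measurable_funD => //; apply: measurable_funM => //.
  exact: measurableT_comp.
- exact: measurable_funM.
Qed.

(* Equality holds for a >= 1 - m: the exponential tail is memoryless. *)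
Lemma mixture_unit_cost_ge1 m a : 0 <= m <= 1 -> (0 <= a)%E ->
  (1 <= m%:E * exponential_mean (fun x => unit_cost (1 - m + x) a) +
        ((1 - m) * unit_cost (1 - m) a)%:E)%E.
Proof.
move=> /andP[m0 m1] a0; set s := 1 - m.
have s0 : 0 <= s by rewrite subr_ge0.
have [as_|sa] := ltP a s%:E.
(* Buying at [r], before every possible end of the season, costs [r + 1] whatever length is
   drawn. *)
- have {a0 as_} [r r0 ar] : exists2 r : R, 0 <= r & a = r%:E /\ r < s.
    by case: a a0 as_ => [r| |]//; rewrite lee_fin lte_fin => *; exists r.
  case: ar => -> rs.
  rewrite (@eq_exponential_mean _ _ (fun=> r + 1)).
    rewrite exponential_mean_cst ?addr_ge0// /ski_cost lte_fin rs /=.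
    by rewrite -EFinM -EFinD lee_fin /s; lra.
  move=> x x0; rewrite /ski_cost lte_fin ifT /= ?mul1r//.
  by rewrite (lt_trans rs)// ltrDl.
(* Buying at [s] or later costs [s] at the atom and [s + 1] on average over the tail, in total m (s
   + 1) + (1 - m) s = m + s = 1. *)
- have -> : unit_cost s a = s by rewrite /ski_cost ltNge sa /= mul1r.
  have -> : exponential_mean (fun x => unit_cost (s + x) a) = (s + 1)%:E.
    case: a a0 sa => [r| |]//; rewrite ?lee_fin => a0 sa.
      (* Beyond [s] the cost is a truncation at [b = r - s] with value [b + 1], for which the terms
         in e^(-b) cancel and the mean is 1. *)
      rewrite (@eq_exponential_mean _ _
        (fun x => s + (if x <= r - s then x else r - s + 1))).
        rewrite exponential_mean_shift//.
        + rewrite /exponential_mean integral_truncation_expR ?subr_ge0//.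
            by rewrite -EFinD; congr EFin; lra.
          by rewrite addr_ge0// subr_ge0.
        + exact: measurable_fun_truncation.
        + move=> x x0; case: ifP => _; first exact: ltW.
          by rewrite addr_ge0// subr_ge0.
      move=> x x0; rewrite /ski_cost lte_fin /= !mul1r.
      by rewrite -ltrBlDl; case: ltP => _; lra.
    rewrite (@eq_exponential_mean _ _ (fun x => s + idfun x)).
      rewrite exponential_mean_shift//; last 2 first.
      + exact: measurable_id.
      + by move=> x /ltW.
      by rewrite exponential_mean_idfun.
    by move=> x x0; rewrite /ski_cost ltNge leey /= mul1r.
  by rewrite -EFinM -EFinD lee_fin /s; lra.
Qed.

End unit_costs.

(** * Averaging over the season length by Tonelli's theorem *)

Section averaging.
Context {R : realType} (d : measure_display) (Omega : measurableType d).
Variables (P : probability Omega R) (X : Omega -> \bar R).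
Hypotheses (X_ge0 : forall w, (0 <= X w)%E) (mX : measurable_fun setT X).
Implicit Types (m s x : R) (B : R -> R).

Let unit_cost : R -> \bar R -> R := ski_cost 1 1.
Let mean_cost x : \bar R := (\int[P]_w (unit_cost x (X w))%:E)%E.

Let mean_cost_ge0 x : 0 <= x -> (0 <= mean_cost x)%E.
Proof.
by move=> x0; apply: integral_ge0 => w _; rewrite lee_fin ski_cost_ge0.
Qed.

Let D : set R := `]0, +oo[%classic.

(** The indicator extends the Exp(1) density by 0, so that Tonelli applies on the full product of
    [Omega] and the real line. *)
Let weighted s : Omega * R -> \bar R :=
  fun z => (unit_cost (s + z.2) (X z.1) * expR (- z.2) * \1_D z.2)%:E.

Let weighted_ge0 s z : 0 <= s -> (0 <= weighted s z)%E.
Proof.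
move=> s0; rewrite lee_fin /weighted indicE.
have [|_] := boolP (z.2 \in D); last by rewrite mulr0.
rewrite inE /D/= in_itv/= andbT => z0.
by rewrite mulr1 mulr_ge0 ?expR_ge0// ski_cost_ge0// addr_ge0// ltW.
Qed.

Let measurable_weighted s : measurable_fun setT (weighted s).
Proof.
apply/measurable_EFinP; apply: measurable_funM; last first.
  by apply: measurableT_comp => //; apply: measurable_indic;
    exact: measurable_itv.
apply: measurable_funM.
  apply: measurable_ski_cost; first exact: measurable_funD.
  exact: measurableT_comp.
apply: measurableT_comp => //.
exact: measurableT_comp.
Qed.

Let weighted_Omega s x : 0 <= s -> D x ->
  (\int[P]_w weighted s (w, x) = mean_cost (s + x) * (expR (- x))%:E)%E.
Proof.
move=> s0 Dx; have x0 : 0 < x by move: Dx; rewrite /D/= in_itv/= andbT.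
rewrite -ge0_integralZr//.
- by apply: eq_integral => w _; rewrite /weighted/= indicE mem_set// mulr1.
- by apply/measurable_EFinP; exact: measurable_ski_cost.
- by move=> w _; rewrite lee_fin ski_cost_ge0// addr_ge0// ltW.
Qed.

Let weighted_R s w : exponential_mean (fun x => unit_cost (s + x) (X w)) =
  (\int[lebesgue_measure]_x weighted s (w, x))%E.
Proof.
rewrite /exponential_mean integral_mkcond.
apply: eq_integral => x _; rewrite patchE /weighted/= indicE -/D.
by case: ifP => _; rewrite ?mulr1 ?mulr0.
Qed.

(** Turns the bound that [mixture_unit_cost_ge1] gives for each seed into one on the mean costs of
    the individual season lengths. *)
Let fubini_weighted s : 0 <= s ->
  (\int[P]_w exponential_mean (fun x => unit_cost (s + x) (X w)) =
   \int[lebesgue_measure]_(x in D) \int[P]_w weighted s (w, x))%E.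
Proof.
move=> s0; rewrite [RHS]integral_mkcond.
under [LHS]eq_integral do rewrite weighted_R.
rewrite (@fubini_tonelli _ _ _ _ _ P (@lebesgue_measure R) (weighted s)).
- apply: eq_integral => x _; rewrite patchE.
  case: ifPn => // xD; apply: integral0_eq => w _.
  by rewrite /weighted/= indicE (negbTE xD) mulr0.
- exact: measurable_weighted.
- by move=> z; exact: weighted_ge0.
Qed.

(** Yao's principle. If the mean cost were below [B] at every positive length, its average over the
    mixture would be below that of [B], hence below 1, whereas it is at least 1. Strictness comes
    from the exponential part if [m > 0] and from the atom if [m = 0]. *)
Lemma exists_mean_cost_ge m B : 0 <= m <= 1 ->
  measurable_fun setT B -> (forall x, 0 < x -> 0 <= B x) ->
  (m%:E * exponential_mean (fun x => B (1 - m + x)%R) + ((1 - m) * B (1 - m))%:E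
     <= 1)%E ->
  exists2 x, 0 < x & ((B x)%:E <= mean_cost x)%E.
Proof.
move=> m01 mB B0; set s := 1 - m => avgB; have /andP[m0 m1] := m01.
have s0 : 0 <= s by rewrite subr_ge0.
apply: contrapT => noX.
have costB x : 0 < x -> (mean_cost x < (B x)%:E)%E.
  by move=> x0; rewrite ltNge; apply/negP => Bx; apply: noX; exists x.
have cost_fin x : 0 < x -> mean_cost x \is a fin_num.
  move=> x0; rewrite ge0_fin_numE; last exact/mean_cost_ge0/ltW.
  exact: lt_trans (costB _ x0) (ltry _).
have mE : measurable_fun setT (fun w =>
    exponential_mean (fun x => unit_cost (s + x) (X w))).
  under eq_fun do rewrite weighted_R.
  apply: (@measurable_fun_fubini_tonelli_F _ _ _ _ _
    (@lebesgue_measure R) (weighted s)).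
  - exact: measurable_weighted.
  - by move=> z; exact: weighted_ge0.
have E0 w : (0 <= exponential_mean (fun x => unit_cost (s + x) (X w)))%E.
  by apply: exponential_mean_ge0 => x x0; rewrite ski_cost_ge0// addr_ge0// ltW.
have avg1 : (1 <=
    m%:E * \int[lebesgue_measure]_(x in D) \int[P]_w weighted s (w, x) +
    s%:E * mean_cost s)%E.
  have mc : measurable_fun setT (fun w => (unit_cost s (X w))%:E).
    by apply/measurable_EFinP; exact: measurable_ski_cost.
  have c0 w : (0 <= (unit_cost s (X w))%:E)%E by rewrite lee_fin ski_cost_ge0.
  have le1 w : (1 <= m%:E * exponential_mean (fun x => unit_cost (s + x) (X w))
      + s%:E * (unit_cost s (X w))%:E)%E by exact: mixture_unit_cost_ge1.
  rewrite -fubini_weighted// -!ge0_integralZl// -ge0_integralD//.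
  - rewrite -[X in (X <= _)%E](@probability_setT _ _ _ P) -[X in (X <= _)%E]mul1e.
    rewrite -integral_cst//; apply: ge0_le_integral => //.
    by apply: emeasurable_funD; exact: measurable_funeM.
  - by move=> w _; rewrite mule_ge0.
  - exact: measurable_funeM.
  - by move=> w _; rewrite mule_ge0.
  - exact: measurable_funeM.
(* [lt_integral] compares real functions. On [D] the mean cost is below [B], hence finite, and
   [fine] loses nothing. *)
pose f x := fine (mean_cost (s + x)) * expR (- x).
have fE x : D x -> (\int[P]_w weighted s (w, x))%E = (f x)%:E.
  move=> Dx; rewrite weighted_Omega// EFinM fineK//; apply: cost_fin.
  by move: Dx; rewrite /D/= in_itv/= andbT => x0; rewrite ltr_wpDl.
have IE : (\int[lebesgue_measure]_(x in D) \int[P]_w weighted s (w, x) =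
    \int[lebesgue_measure]_(x in D) (f x)%:E)%E.
  by apply: eq_integral => x; rewrite inE => /fE.
have mf : measurable_fun D (EFin \o f).
  apply: (eq_measurable_fun (fun x => \int[P]_w weighted s (w, x))%E).
    by move=> x; rewrite inE => /fE.
  apply: measurable_funTS.
  apply: (@measurable_fun_fubini_tonelli_G _ _ _ _ _ P (weighted s)).
  - exact: measurable_weighted.
  - by move=> z; exact: weighted_ge0.
(* [s] is both the position and the mass of the atom. If it is 0, the comparison with [B], known
   only at positive lengths, is multiplied by 0. *)
have sB : (s%:E * mean_cost s <= (s * B s)%:E)%E.
  have [->|sN0] := eqVneq s 0; first by rewrite mul0r mul0e.
  by rewrite EFinM lee_wpmul2l// ltW// costB// lt_neqAle eq_sym sN0.
have [m00|mN0] := eqVneq m 0.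
  have s1 : s = 1 by rewrite /s m00 subr0.
  move: avg1 avgB; rewrite m00 !mul0e !add0e s1 mul1e mul1r => c1 B1.
  by have := costB _ ltr01; rewrite ltNge (le_trans _ c1).
have m_gt0 : 0 < m by rewrite lt_neqAle eq_sym mN0.
have G0 : (0 <= exponential_mean (fun x => B (s + x)%R))%E.
  by apply: exponential_mean_ge0 => x x0; rewrite B0// ltr_wpDl.
(* An infinite mean, weighted by [m > 0], would violate [avgB]. *)
have Goo : (exponential_mean (fun x => B (s + x)%R) < +oo)%E.
  rewrite ltey; apply/eqP => Goo.
  by move: avgB; rewrite Goo gt0_muley ?lte_fin// addye// leye_eq.
have : (\int[lebesgue_measure]_(x in D) (f x)%:E
    < exponential_mean (fun x => B (s + x)%R))%E.
  apply: lt_integral => //.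
  - exact: measurable_itv.
  - by rewrite /= /D lebesgue_measure_itv/= !ltry.
  - apply: measurable_mul_expRN; apply: measurableT_comp => //.
    exact: measurable_funD.
  - move=> x; rewrite /D/= in_itv/= andbT => x0.
    by rewrite mulr_ge0 ?expR_ge0// fine_ge0// mean_cost_ge0// addr_ge0// ltW.
  - move=> x; rewrite /D/= in_itv/= andbT => x0.
    have sx0 : 0 < s + x by rewrite ltr_wpDl.
    by rewrite ltr_pM2r ?expR_gt0// -lte_fin fineK ?cost_fin ?costB.
move: avg1 avgB; rewrite IE.
case: (exponential_mean _) G0 Goo => [g| |]// _ _.
case: (\int[lebesgue_measure]_(x in D) (f x)%:E)%E => [i| |]//; last first.
  by rewrite gt0_muleNy ?lte_fin// => /le_trans/(_ _)/wrap[].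
move=> avg1 avgB; rewrite lte_fin => ig.
(* The contradiction is 1 <= m i + s B(s) < m g + s B(s) <= 1. *)
have := le_trans avg1 (leeD2l _ sB).
rewrite -!EFinM -EFinD lee_fin; move: avgB; rewrite -!EFinM -EFinD lee_fin.
have : m * i < m * g by rewrite ltr_pM2l.
lra.
Qed.
End averaging.

(** * General costs and the choice of the season distribution *)

(** After rescaling, the prediction lies [b] beyond the atom 1 - m. The last hypothesis bounds the
    average of rho OPT + nu eta by 1: over the tail, OPT has mean 1 - m + (1 - e^(-m)) and the error
    b - 1 + 2 e^(-b); at the atom they equal 1 - m and b. *)
Lemma exists_expected_ski_cost_ge (R : realType) (d : measure_display)
    (Omega : measurableType d) (P : probability Omega R)
    (A : ski_algorithm R Omega) (alpha beta rho nu m b : R) :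
  0 < alpha -> 0 < beta -> 0 <= rho -> 0 <= nu -> 0 <= m <= 1 -> 0 <= b ->
  m * (rho * (1 - m + (1 - expR (- m))) + nu * (b - 1 + 2 * expR (- b))) +
    (1 - m) * (rho * (1 - m) + nu * b) <= 1 ->
  exists tau ell : R, [/\ 0 <= tau, 0 < ell &
    ((rho * ski_opt alpha beta ell + nu * pred_error alpha tau ell)%:E
       <= expected_ski_cost P A alpha beta tau ell)%E].
Proof.
move=> alpha0 beta0 rho0 nu0 m01 b0 avg; have /andP[m0 m1] := m01.
have alphaN0 : alpha != 0 by rewrite gt_eqF.
have betaN0 : beta != 0 by rewrite gt_eqF.
(* The prediction is fixed before the season length is found, so [X] is a single random variable,
   the same for all lengths. *)
pose t := 1 - m + b; pose tau := beta / alpha * t.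
have t0 : 0 <= t by rewrite addr_ge0// subr_ge0.
pose X w : \bar R := ((alpha / beta)%:E * A alpha beta tau w)%E.
have mX : measurable_fun setT X.
  by apply: measurable_funeM; exact: measurable_buy_time.
have X0 w : (0 <= X w)%E.
  by rewrite mule_ge0 ?buy_time_ge0// lee_fin divr_ge0// ltW.
(* The target rho OPT + nu eta in rescaled units; both it and the expected cost get multiplied by
   [beta] at the end. *)
pose B x : R := rho * Num.min x 1 + nu * `|t - x|.
have mmin (c : R) : measurable_fun setT (fun x : R => Num.min x c).
  exact: measurable_minr.
have mdist (c : R) : measurable_fun setT (fun x : R => `|c - x|).
  by apply: measurableT_comp => //; exact: measurable_funB.
have mB : measurable_fun setT B.
  by apply: measurable_funD; apply: measurable_funM.
have min0 (c x : R) : 0 <= c -> 0 < x -> 0 <= Num.min x c.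
  by move=> c0 x0; rewrite le_min c0 ltW.
have B0 x : 0 < x -> 0 <= B x.
  by move=> x0; rewrite addr_ge0// mulr_ge0// min0.
have avgB : (m%:E * exponential_mean (fun x => B (1 - m + x)%R) +
    ((1 - m) * B (1 - m))%:E <= 1)%E.
  rewrite (@eq_exponential_mean _ _
    (fun x => rho * (1 - m + Num.min x m) + nu * `|b - x|)); last first.
    move=> x x0; rewrite /B /t opprD addrACA subrr add0r.
    congr (rho * _ + _); rewrite !minEle; case: ifP; case: ifP => //; lra.
  rewrite exponential_mean_linear//; last 2 first.
  - exact: measurable_funD.
  - by move=> x x0; rewrite addr_ge0 ?subr_ge0// min0.
  rewrite exponential_mean_shift ?subr_ge0//; last by move=> x; exact: min0.
  rewrite exponential_mean_minr// exponential_mean_dist//.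
  rewrite -EFinD lee_fin /B.
  have -> : Num.min (1 - m) 1 = 1 - m by apply/min_idPl; lra.
  by rewrite /t (addrC _ b) addrK (ger0_norm b0).
have [x x0 Bx] := @exists_mean_cost_ge _ _ _ P X X0 mX m B m01 mB B0 avgB.
exists tau, (beta / alpha * x); split.
- by rewrite mulr_ge0// divr_ge0// ltW.
- by rewrite mulr_gt0// divr_gt0.
have -> : expected_ski_cost P A alpha beta tau (beta / alpha * x) =
    (beta%:E * \int[P]_w (ski_cost 1 1 x (X w))%:E)%E.
  rewrite /expected_ski_cost unlock -ge0_integralZl//.
  - by apply: eq_integral => w _; rewrite ski_cost_scale.
  - by apply/measurable_EFinP; exact: measurable_ski_cost.
  - by move=> w _; rewrite lee_fin ski_cost_ge0// ltW.
  - by rewrite lee_fin ltW.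
have -> : rho * ski_opt alpha beta (beta / alpha * x) +
    nu * pred_error alpha tau (beta / alpha * x) = beta * B x.
  have -> : ski_opt alpha beta (beta / alpha * x) = beta * Num.min x 1.
    by rewrite /ski_opt minr_pMr ?ltW// mulr1; congr Num.min; field.
  have -> : pred_error alpha tau (beta / alpha * x) = beta * `|t - x|.
    rewrite /pred_error /tau -mulrBr normrM gtr0_norm ?divr_gt0//.
    by field.
  by rewrite /B; ring.
by rewrite EFinM lee_pmul2l// lte_fin.
Qed.

Theorem theorem2 (R : realType) (rho : R)
    (hrho : 1 <= rho <= expR 1 / (expR 1 - 1))
    (d : measure_display) (Omega : measurableType d) (P : probability Omega R)
    (A : ski_algorithm R Omega)
    (alpha beta : R) (halpha : 0 < alpha) (hbeta : 0 < beta) :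
  exists tau ell : R, [/\ 0 <= tau, 0 < ell &
    ((rho * ski_opt alpha beta ell + mu rho * pred_error alpha tau ell)%:E
       <= expected_ski_cost P A alpha beta tau ell)%E].
Proof.
have /andP[rho1 rhoe] := hrho.
have rho_gt0 : 0 < rho by apply: lt_le_trans rho1.
have [/andP[T0 T1] TE] := mu_TP hrho.
rewrite /mu; set T := mu_T rho in T0 T1 TE *.
set mu1 := _ / ln 2; set mu2 := _ * expR (- T).
have e_gt1 : 1 < expR 1 :> R by rewrite expR_gt1.
have ln2_gt0 : 0 < ln 2 :> R by rewrite ln_gt0// ltr1n.
have eN : (expR 1 - 1) / expR 1 = 1 - expR (- 1) :> R.
  by rewrite expRN mulrBl divff ?mul1r// gt_eqF ?expR_gt0.
(* This amounts to rho <= e / (e - 1). *)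
have mu1_ge0 : 0 <= mu1.
  rewrite divr_ge0 ?(ltW ln2_gt0)// subr_ge0 mulrA ler_pdivrMr ?expR_gt0// mul1r.
  by rewrite -ler_pdivlMr ?subr_gt0.
have mu2_ge0 : 0 <= mu2 by rewrite !mulr_ge0 ?subr_ge0 ?expR_ge0 ?(ltW rho_gt0).
have [_|_] := leP mu1 mu2.
(* Prediction at the atom: the average is rho (1 - T e^(-T)) + mu2 T = rho (1 - T^2 e^(-T)), which
   is 1 by the equation defining T. *)
- apply: (@exists_expected_ski_cost_ge _ _ _ _ _ _ _ _ _ T 0) => //.
  + exact: ltW.
  + by rewrite T0.
  have : rho * (1 - T ^+ 2 * expR (- T)) = 1.
    by rewrite TE subKr divff ?gt_eqF.
  rewrite /mu2 oppr0 expR0; nra.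
(* The atom has no mass, and b = ln 2 minimizes the mean error b - 1 + 2 e^(-b), with value ln 2.
   The average is rho (1 - 1/e) + mu1 ln 2 = 1. *)
- apply: (@exists_expected_ski_cost_ge _ _ _ _ _ _ _ _ _ 1 (ln 2)) => //.
  + exact: ltW.
  + by rewrite lexx ler01.
  + exact: ltW.
  have -> : expR (- ln 2) = 2^-1 :> R by rewrite expRN lnK ?posrE.
  have : mu1 * ln 2 = 1 - rho * (1 - expR (- 1)).
    by rewrite /mu1 eN divfK// gt_eqF.
  nra.
Qed.
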